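(* When $G$ is simple, the map $\psi: \mathcal{M} \to \mathcal{J}$, $m \mapsto J_m$, is a bijection with inverse given by $\mathcal{J} \to \mathcal{M}$, $J \mapsto m_J$.
   Context: $G$ is a connected semi-simple algebraic group over an algebraically closed field $\mathbf{k}$ (assumed simple in the statement), $(B,B^-)$ a pair of opposite Borel subgroups, $H = B\cap B^-$, $W = N_G(H)/H$ the Weyl group, $\Gamma$ the set of simple roots determined by $(B,H)$, $s_\alpha\in W$ the reflection for $\alpha \in \Gamma$, and $l$ the length function on $W$. $\langle\,,\rangle$ is a $W$-invariant inner product on the real span of the roots. $w_0$ is the longest element of $W$. For $J \subset \Gamma$, $w_{0,J}$ is the longest element of the subgroup $W_J$ generated by $\{s_\alpha : \alpha\in J\}$. Let $\delta_0(\alpha) = -w_0(\alpha)$ for roots $\alpha$. $\mathcal{M}$ is the set of all $m \in W$ such that $m$ is the unique maximal length element in its conjugacy class $\mathcal{O}_m$ in $W$. For $m\in\mathcal{M}$, $J_m = \{\alpha \in \Gamma : m(\alpha) = \alpha\}$. For $J \subset \Gamma$, $m_J = w_0 w_{0,J}$. A subset $J\subset\Gamma$ has Property (1) if $J$ is $\delta_0$-invariant and $-w_0(\alpha) = -w_{0,J}(\alpha)$ for all $\alpha\in J$. An element $\alpha\in J$ is isolated if $\langle\alpha,\alpha'\rangle = 0$ for every $\alpha' \in J\setminus\{\alpha\}$. A subset $J \subset \Gamma$ has Property (2) if for every isolated $\alpha\in J$ there is no $\beta\in\Gamma\setminus\{\alpha\}$ with all of the following properties: a) $\langle\alpha,\alpha\rangle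 = \langle\beta,\beta\rangle$ and $\langle\beta,\alpha\rangle\neq 0$; b) $\langle\beta,\alpha'\rangle = 0$ for all $\alpha'\in J\setminus\{\alpha\}$; c) $-w_0(\beta)=\beta$. $\mathcal{J}$ is the collection of all subsets $J$ of $\Gamma$ with Properties (1) and (2). *)

(* Defs.v *)
From HB Require Import structures.
From mathcomp Require Import all_boot all_order all_fingroup all_algebra.

Set Implicit Arguments.
Unset Strict Implicit.
Unset Printing Implicit Defensive.

Import GroupScope Order.TTheory GRing.Theory Num.Theory.
Local Open Scope ring_scope.

Section Reflection.
Variables (R : realFieldType) (V : vectType R) (dot : {dot V for idfun}).

Definition reflection (a v : V) : V := v - (2 * dot v a / dot a a) *: a.

End Reflection.

(* The roots of a connected semisimple group with respect to a maximal torus: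
   [V] is the real span of the roots and [rs_dot] the inner product. As the
   reflections are the orthogonal ones, [rs_dot] is invariant under the Weyl
   group; conversely, the reflections of a root system are orthogonal for any
   inner product that is invariant under its Weyl group. *)
Record rootSystem (R : realFieldType) (V : vectType R) := RootSystem {
  rs_dot : {dot V for idfun};
  rs_roots : seq V;
  rs_neq0 : 0 \notin rs_roots;
  rs_span : <<rs_roots>>%VS = fullv;
  rs_closed : forall a b : V, a \in rs_roots -> b \in rs_roots ->
    reflection rs_dot a b \in rs_roots;
  rs_integral : forall a b : V, a \in rs_roots -> b \in rs_roots ->
    exists z : int, 2 * rs_dot b a / rs_dot a a = z%:~R;
  rs_reduced : forall (a : V) (c : R), a \in rs_roots ->
    c *: a \in rs_roots -> c = 1 \/ c = -1
}.

Notation root_of Phi := (seq_sub (rs_roots Phi)).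

Fact expgs_lt_card (gT : finGroupType) (G : {group gT}) (S : {set gT}) n x :
  S \subset G -> x \in (S ^+ n)%g ->
  (forall k, (k < n)%N -> x \notin (S ^+ k)%g) -> (n < #|G|)%N.
Proof.
move=> sSG xS xmin.
have lt_sum j k : (j < k)%N -> (k <= n)%N -> (j + (n - k) < n)%N.
  by move=> jk kn; rewrite -{2}(subnKC kn) ltn_add2r.
have ex (k : 'I_n.+1) : exists u, [&& u \in G, u \in (S ^+ k)%g &
    [forall j : 'I_k, u \notin (S ^+ j)%g]].
  have : x \in (S ^+ k * S ^+ (n - k))%g.
    by rewrite -expgD subnKC // -ltnS.
  case/mulsgP=> u v uS vS xE; exists u; apply/and3P; split=> //.
    suff sk m : (S ^+ m)%g \subset G by exact: subsetP (sk k) u uS.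
    elim: m => [|m IHm]; first by rewrite expg0 sub1G.
    by rewrite expgS mul_subG.
  apply/forallP=> j; apply/negP=> uj.
  have jk : (j < k)%N := ltn_ord j.
  have kn : (k <= n)%N by rewrite -ltnS.
  have /negP[] := xmin (j + (n - k))%N (lt_sum _ _ jk kn).
  by rewrite expgD xE mem_mulg.
pose f k := xchoose (ex k).
have fP k : [&& f k \in G, f k \in (S ^+ k)%g &
    [forall j : 'I_k, f k \notin (S ^+ j)%g]] := xchooseP (ex k).
rewrite -[n.+1]card_ord -(card_imset predT (f := f)) => [|j k fE].
  by apply/subset_leq_card/subsetP=> _ /imsetP[k _ ->]; case/and3P: (fP k).
have [/and3P[_ jS /forallP jm] /and3P[_ kS /forallP km]] := (fP j, fP k).
apply: val_inj; case: (ltngtP j k) => // lt.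
  by have := km (Ordinal lt); rewrite -fE jS.
by have := jm (Ordinal lt); rewrite fE kS.
Qed.

Section WeylGroup.
Variables (R : realFieldType) (V : vectType R) (Phi : rootSystem V).
Implicit Types (a b : root_of Phi) (A Gamma J : {set root_of Phi}).
Implicit Types w m : {perm root_of Phi}.

Definition ip a b : R := rs_dot Phi (val a) (val b).

Fact ip_gt0 a : 0 < ip a a.
Proof.
apply: neq0_dnorm_gt0; apply: contraNneq (rs_neq0 Phi) => <-; exact: valP.
Qed.

Definition refl_root a b : root_of Phi :=
  SeqSub (rs_closed (valP a) (valP b)).

Fact refl_root_inj a : injective (refl_root a).
Proof.
apply: (can_inj (g := refl_root a)) => b; apply: val_inj => /=.
rewrite /reflection linearBl linearZl_LR /= -/(ip a a) -/(ip b a).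
have ne := lt0r_neq0 (ip_gt0 a).
rewrite divfK // [2 * (_ - _)]mulrBr mulrA [2 * 2]mulrDl mul1r mulrDl.
rewrite opprD addrA subrr sub0r mulNr scaleNr opprK.
by rewrite -addrA addNr addr0.
Qed.

Definition s_ a : {perm root_of Phi} := perm (@refl_root_inj a).

Fact opp_root_subproof a : - val a \in rs_roots Phi.
Proof.
have := rs_closed (valP a) (valP a).
rewrite /reflection -/(ip a a) mulfK ?(lt0r_neq0 (ip_gt0 a)) //.
by rewrite scaler_nat mulr2n opprD addrA subrr sub0r.
Qed.

Definition opp_root a : root_of Phi := SeqSub (opp_root_subproof a).

(* The action of the Weyl group on the roots is faithful, so that its elements
   are represented by the permutations of the roots that they induce. In
   {perm _}, [(u * v) a = v (u a)]: the composition [u \o v] is [v * u]. *)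
Definition weyl : {group {perm root_of Phi}} := <<[set s_ a | a in setT]>>%G.

(* Equivalent to the simplicity of the semisimple group. *)
Definition irreducible : Prop :=
  setT != set0 :> {set root_of Phi} /\
  forall A, (forall a b, a \in A -> b \notin A -> ip a b = 0) ->
    A = set0 \/ A = setT.

(* The bases are the sets of simple roots of the Borel subgroups that contain
   the maximal torus. *)
Definition is_base Gamma : Prop :=
  basis_of fullv [seq val a | a <- enum Gamma] /\
  forall b, exists c : root_of Phi -> nat,
    let v := \sum_(a in Gamma) (c a)%:R *: val a in
    val b = v \/ val b = - v.

(* The subgroup W_J, for J a set of simple roots. *)
Definition parabolic J : {group {perm root_of Phi}} :=
  <<[set s_ a | a in J]>>%G.

Section Base.
Variable Gamma : {set root_of Phi}.

(* The least n such that w is a product of n simple reflections: [find]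
   returns the first n < #|weyl| that works. By [lengthP] one exists when w is
   in the group generated by the simple reflections, which is [weyl]. *)
Definition length w : nat :=
  find (fun n => w \in ([set s_ a | a in Gamma] ^+ n)%g) (iota 0 #|weyl|).

Fact lengthP w : w \in parabolic Gamma ->
  w \in ([set s_ a | a in Gamma] ^+ length w)%g /\
  forall n, w \in ([set s_ a | a in Gamma] ^+ n)%g -> (length w <= n)%N.
Proof.
set S := [set s_ a | a in Gamma] => wW.
have exP : exists n, w \in (S ^+ n)%g.
  have [n Wn] := gen_expgs S; move: wW; rewrite /parabolic /= Wn {Wn}.
  elim: n w => [|n IHn] w; first by exists 0%N.
  rewrite expgS => /mulsgP[x y /setU1P[-> /IHn[k yk] ->|xS /IHn[k yk] ->]].
    by exists k; rewrite mul1g.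
  by exists k.+1; rewrite expgS mem_mulg.
have [n wn nmin] := ex_minnP exP.
have n_lt : (n < #|weyl|)%N.
  apply: (@expgs_lt_card _ weyl S n w) => // [|k].
    rewrite (subset_trans _ (subset_gen _)) //.
    by apply/subsetP=> _ /imsetP[a _ ->]; apply: imset_f.
  by rewrite ltnNge; apply: contra => /nmin.
rewrite /length -/S; set P := fun n => _.
have hasP : has P (iota 0 #|weyl|).
  by apply/hasP; exists n; rewrite ?mem_iota.
have lt_find := hasP; rewrite has_find size_iota in lt_find.
split=> [|k wk]; first by have := nth_find 0%N hasP; rewrite nth_iota.
rewrite leqNgt; apply/negP=> ltk.
have := before_find 0%N ltk; rewrite nth_iota ?(ltn_trans ltk) //.
by rewrite /P add0n wk.
Qed.

(* [arg max_(w > w1 in A) f w] is an element of A at which f is maximal,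
   provided that w1 \in A. *)
Definition longest J : {perm root_of Phi} :=
  [arg max_(w > 1%g in parabolic J) length w].

Definition w0 : {perm root_of Phi} := [arg max_(w > 1%g in weyl) length w].

Definition delta0 a : root_of Phi := opp_root (w0 a).

Definition calM : {set {perm root_of Phi}} :=
  [set m in weyl |
    [forall w in m ^: weyl, (w != m) ==> (length w < length m)%N]].

Definition J_ m : {set root_of Phi} := [set a in Gamma | m a == a].

(* w_0 w_{0,J} as a composition *)
Definition m_ J : {perm root_of Phi} := (longest J * w0)%g.

Definition property1 J : bool :=
  (delta0 @: J == J) &&
  [forall a in J, opp_root (w0 a) == opp_root (longest J a)].

Definition isolated J a : bool :=
  (a \in J) && [forall a' in J :\ a, ip a a' == 0].

Definition property2 J : bool :=
  [forall (a | isolated J a), ~~ [exists b in Gamma :\ a,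
    [&& ip a a == ip b b, ip b a != 0,
        [forall a' in J :\ a, ip b a' == 0] & opp_root (w0 b) == b]]].

Definition calJ : {set {set root_of Phi}} :=
  [set J : {set root_of Phi} | [&& J \subset Gamma, property1 J & property2 J]].

End Base.
End WeylGroup.

(* Main.v *)
Require Import Defs.
From HB Require Import structures.
From mathcomp Require Import all_boot all_order all_fingroup all_algebra.
From mathcomp Require Import zify lra.

(** Call an element [w] of the Weyl group terminal if every simple root [a] is
either fixed by [w] or sent to a negative root.

An element [m] of maximal length that is alone in this in its class is
terminal: if [m a > 0], conjugating by [s_ a] does not shorten [m], so that [m]
commutes with [s_ a] and fixes [a] ([calM_terminal]). A terminal [m] is
determined by the set [J] of the simple roots that it fixes: [m] after the
longest element of [W_J] sends all simple roots to negative ones, hence is [w0],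
so that [m = m_J] ([terminal_eq]), and property (1) follows
([terminal_property1]). If [a], [b] contradicted property (2), then [m b] would
be [- (a + b)], and conjugating [m] by [s_ b], then by [s_ a], would first lose
at most 2 in length, then gain 2, which gives a second element of maximal length
([calM_property2]).

Conversely, let [J] have properties (1) and (2). Then [m = m_J] is a terminal
involution that fixes exactly the simple roots in [J], and it remains to see
that it is longer than its other conjugates. For an involution [x], a simple
root [a] with [x a > 0] and [x a <> a] gives a climb: conjugation by [s_ a] adds
2 to the length, and the terminal involutions are those from which no climb
starts. The point is that every conjugate of [m] climbs to [m]
([class_reach]). As for a confluent rewriting system, this is reduced to a local
statement about two climbs from the same [x], along [a] and [b]:
- if [x a <> b], then [x] moves every root in the span of [a] and [b] out of
  that span, and both climbs continue to the conjugate of [x] by the longest element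
  of the dihedral group of [s_ a] and [s_ b] ([confluence]);
- if [x a = b] and [a], [b] are orthogonal, the two climbs have the same result
  ([swap_orth]);
- if [x a = b] and [a], [b] are not orthogonal, these roots of equal length span
  a system of type A2, and the climbs may diverge.
  When a third climb starts from [x], along [c], one passes from [b] to [c] and
  from [c] to [a] by the first case. Otherwise the conjugate of [x] by [s_ b] is
  terminal ([swap_terminal]), so it is [m]; it fixes [a] and maps [b] to
  [- (a + b)], which contradicts property (2) ([A2_not_property2]). *)

Set Implicit Arguments.
Unset Strict Implicit.
Unset Printing Implicit Defensive.

Import GroupScope Order.TTheory GRing.Theory Num.Theory.
Local Open Scope ring_scope.

(** * Reflections and the action of the Weyl group *)

Lemma gen_ind (gT : finGroupType) (S : {set gT}) (P : gT -> Prop) :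
  P 1%g -> (forall x y, x \in S -> y \in <<S>>%g -> P y -> P (x * y)%g) ->
  forall x, x \in <<S>>%g -> P x.
Proof.
move=> P1 PM x /gen_prodgP[n [c Sc ->]]; elim: n c Sc => [|n IHn] c Sc.
  by rewrite big_ord0.
rewrite big_ord_recl; apply: PM; [exact: Sc | | exact: IHn].
by apply: group_prod => i _; apply: mem_gen.
Qed.

Section RootSystem.
Variables (R : realFieldType) (V : vectType R) (Phi : rootSystem V).
Implicit Types (a b c d : root_of Phi) (u v w x y z : {perm root_of Phi}).

Definition cartan b a : R := 2 * ip b a / ip a a.

Lemma ipC a b : ip a b = ip b a.
Proof. by rewrite /ip (hermC (rs_dot Phi)) /= expr0 mul1r. Qed.

Lemma ip_neq0 a : ip a a != 0. Proof. exact: lt0r_neq0 (ip_gt0 a). Qed.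

Lemma cartan_int b a : exists z : int, cartan b a = z%:~R.
Proof. exact: rs_integral (valP a) (valP b). Qed.

Lemma cartan_id a : cartan a a = 2.
Proof. by rewrite /cartan mulfK ?ip_neq0. Qed.

Lemma cartanM b a : cartan b a * ip a a = 2 * ip b a.
Proof. by rewrite /cartan divfK ?ip_neq0. Qed.

Lemma sE a b : val (s_ a b) = val b - cartan b a *: val a.
Proof. by rewrite permE. Qed.

Lemma s_id a : s_ a a = opp_root a.
Proof.
apply: val_inj; rewrite sE cartan_id /=.
by rewrite scaler_nat mulr2n opprD addrA subrr sub0r.
Qed.

Lemma root_neq0 a : val a != 0.
Proof. by apply: contraNneq (rs_neq0 Phi) => <-; exact: valP. Qed.

Lemma opp_rootK : involutive (@opp_root R V Phi).
Proof. by move=> a; apply: val_inj; rewrite /= opprK. Qed.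

Lemma ip_sl a b c : ip (s_ a b) c = ip b c - cartan b a * ip a c.
Proof. by rewrite /ip sE linearBl linearZl_LR. Qed.

Lemma ip_oppr a b : ip b (opp_root a) = - ip b a.
Proof. exact: linearN. Qed.

Lemma ip_oppl a b : ip (opp_root a) b = - ip a b.
Proof. by rewrite ipC ip_oppr ipC. Qed.

Lemma ip_s a b c : ip (s_ a b) (s_ a c) = ip b c.
Proof.
rewrite ip_sl (ipC b) (ipC a) !ip_sl (ipC c b) (ipC a b).
have eb := cartanM b a; have ec := cartanM c a.
have : cartan b a * (cartan c a * ip a a) = cartan b a * (2 * ip c a).
  by rewrite ec.
have : cartan c a * (cartan b a * ip a a) = cartan c a * (2 * ip b a).
  by rewrite eb.
lra.
Qed.

Lemma sK a : involutive (s_ a).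
Proof.
move=> b; apply: val_inj.
rewrite !sE; have -> : cartan (s_ a b) a = - cartan b a.
  apply: (mulIf (ip_neq0 a)); rewrite mulNr !cartanM ip_sl.
  by have := cartanM b a; lra.
by rewrite scaleNr opprK subrK.
Qed.

Lemma s_sqr a : (s_ a * s_ a = 1)%g.
Proof. by apply/permP=> b; rewrite permM perm1 sK. Qed.

Lemma sV a : ((s_ a)^-1 = s_ a)%g.
Proof. by apply/eqP; rewrite eq_invg_mul s_sqr. Qed.

Lemma s_weyl a : s_ a \in weyl Phi.
Proof. by apply/mem_gen/imset_f. Qed.

Lemma ip_weyl w a b : w \in weyl Phi -> ip (w a) (w b) = ip a b.
Proof.
move=> wW; move: w wW a b; apply: gen_ind => [|x y /imsetP[c _ ->] _ IH] a b.
  by rewrite !perm1.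
by rewrite !permM IH ip_s.
Qed.

(** Elements of [weyl] are mere permutations of the roots; this recovers the
linear relations between roots that they preserve. *)
Lemma weyl_linear w : w \in weyl Phi ->
  exists f : 'End(V), forall a, val (w a) = f (val a).
Proof.
move: w; apply: gen_ind => [|x y /imsetP[c _ ->] _ [f fE]].
  by exists \1%VF => a; rewrite perm1 id_lfunE.
pose r (p : V) : V := f (p - (2 * rs_dot Phi p (val c) / ip c c) *: val c).
have r_linear : linear r.
  move=> t p q; rewrite /r linearDl linearZl_LR /= -linearP; congr (f _).
  rewrite scalerBr scalerA addrACA -opprD -scalerDl; congr (_ + _ - _ *: _).
  by rewrite mulrDr mulrDl mulrCA !mulrA.
pose rL := GRing.isLinear.Build _ _ _ _ r r_linear.
pose r' : {linear V -> V} := HB.pack r rL.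
exists (linfun r') => a; rewrite lfunE permM fE /= /r sE //.
Qed.

Lemma weyl_opp w a : w \in weyl Phi -> w (opp_root a) = opp_root (w a).
Proof.
by case/weyl_linear=> f fE; apply: val_inj; rewrite /= !fE /= linearN.
Qed.

Lemma sJ w a : w \in weyl Phi -> (s_ a ^ w)%g = s_ (w a).
Proof.
move=> wW; have [f fE] := weyl_linear wW.
apply/permP=> b; rewrite conjgE !permM -{2}(permKV w b); apply: val_inj.
by rewrite !(fE, sE) /cartan !ip_weyl // linearB linearZ.
Qed.

Lemma weyl_s w a b : w \in weyl Phi -> w (s_ a b) = s_ (w a) (w b).
Proof. by move=> wW; rewrite -sJ // conjgE !permM permK. Qed.

Lemma s_opp a : s_ (opp_root a) = s_ a.
Proof. by rewrite -s_id -sJ ?s_weyl // conjgE sV s_sqr mulg1. Qed.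

Lemma reduced a b (t : R) : val b = t *: val a -> b = a \/ b = opp_root a.
Proof.
move=> bE; have := valP b; rewrite bE => /(rs_reduced (valP a))[] tE.
  by left; apply: val_inj; rewrite bE tE scale1r.
by right; apply: val_inj; rewrite bE tE scaleN1r.
Qed.

(** * Coordinates in a base, positive roots *)

Section Base.
Variable Gamma : {set root_of Phi}.
Hypothesis baseGamma : is_base Gamma.
Implicit Types (I J K : {set root_of Phi}).

Let X := [seq val a | a <- enum Gamma].

(** The coordinate along [a]. As a sum over the indices at which [val a] occurs
in the basis (at most one), it is linear and makes sense for all roots [a]. *)
Definition coef a (p : V) : R :=
  \sum_(i < size X | X`_i == val a) coord (in_tuple X) i p.

Lemma coef_is_linear a : scalar (coef a).
Proof.
move=> t p q; rewrite /coef mulr_sumr -big_split /=.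
by apply: eq_bigr => i _; rewrite linearP.
Qed.
HB.instance Definition _ a :=
  GRing.isLinear.Build R V R *%R (coef a) (coef_is_linear a).

Lemma coef_simple a b : b \in Gamma -> coef a (val b) = (a == b)%:R.
Proof.
have [bas _] := baseGamma; have frX := basis_free bas.
rewrite -mem_enum => bG; have bX : val b \in X by apply: map_f.
have := bX; rewrite -index_mem => ltb.
have bE : val b = (in_tuple X)`_(Ordinal ltb) by rewrite /= nth_index.
rewrite {1}bE /coef.
under eq_bigr do rewrite coord_free //.
rewrite big_mkcond (bigD1 (Ordinal ltb)) //= big1 ?addr0 => [|i /negPf ne].
  by rewrite nth_index // eqxx (inj_eq val_inj) eq_sym; case: eqP.
by rewrite [_ == i]eq_sym ne; case: ifP.
Qed.

Lemma coef_sum p : p = \sum_(a in Gamma) coef a p *: val a.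
Proof.
have [bas _] := baseGamma; have uX := free_uniq (basis_free bas).
rewrite {1}(coord_basis (X := in_tuple X) bas (memvf p)) /=.
rewrite -[RHS](big_enum _ _ Gamma (fun a => coef a p *: val a)) /=.
rewrite -(big_map val predT (fun q => (\sum_(i < size X | X`_i == q)
  coord (in_tuple X) i p) *: q)) -/X (big_nth 0) big_mkord.
apply: eq_bigr => i _; rewrite (bigD1 i) //= big1 ?addr0 // => j /andP[].
by rewrite nth_uniq // -(inj_eq val_inj) => ->.
Qed.

Lemma coef_inj p q : (forall a, a \in Gamma -> coef a p = coef a q) -> p = q.
Proof.
by move=> e; rewrite (coef_sum p) (coef_sum q); apply: eq_bigr => a /e ->.
Qed.

Definition pos b := [forall a in Gamma, 0 <= coef a (val b)].

Lemma posP b : reflect (forall a, a \in Gamma -> 0 <= coef a (val b)) (pos b).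
Proof. exact: forall_inP. Qed.

Lemma coef_opp a b : coef a (val (opp_root b)) = - coef a (val b).
Proof. exact: linearN. Qed.

Lemma coef_s a b c : coef c (val (s_ a b)) =
  coef c (val b) - cartan b a * coef c (val a).
Proof. by rewrite sE linearB linearZ. Qed.

Lemma pos_simple a : a \in Gamma -> pos a.
Proof. by move=> aG; apply/posP=> b _; rewrite coef_simple // ler0n. Qed.

Lemma pos_or_opp b : pos b \/ pos (opp_root b).
Proof.
have [_ /(_ b)[c cE]] := baseGamma.
pose v := \sum_(a in Gamma) (c a)%:R *: val a.
have {cE} vE : val b = v \/ val b = - v by exact: cE.
have coef_v a : a \in Gamma -> coef a v = (c a)%:R.
  move=> aG; rewrite linear_sum (bigD1 a) //= big1 ?addr0 => [|d /andP[dG]].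
    by rewrite linearZ /= coef_simple // eqxx mulr1.
  by rewrite linearZ /= coef_simple // eq_sym => /negPf ->; rewrite mulr0.
by case: vE => vE; [left | right]; apply/posP=> a aG;
  rewrite ?coef_opp vE ?linearN /= ?opprK coef_v ?ler0n.
Qed.

Lemma pos_ex b : pos b -> exists2 a, a \in Gamma & 0 < coef a (val b).
Proof.
move/posP=> b_ge0; case: (pickP [pred a in Gamma | 0 < coef a (val b)]).
  by move=> a /andP[aG a_gt0]; exists a.
move=> no; case/eqP: (root_neq0 b); apply: coef_inj => a aG.
rewrite linear0; apply/eqP; have := no a.
by rewrite /= aG /= lt_def b_ge0 // andbT => /negbFE.
Qed.

Lemma pos_opp b : pos (opp_root b) = ~~ pos b.
Proof.
case: (boolP (pos b)) => [bp | /negPf bn]; last first.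
  by case: (pos_or_opp b) => //; rewrite bn.
apply/negP=> /posP obp; have [a aG] := pos_ex bp; apply/negP.
by rewrite -leNgt -oppr_ge0 -coef_opp obp.
Qed.

Lemma coef_gt0_pos a b : a \in Gamma -> 0 < coef a (val b) -> pos b.
Proof.
move=> aG a_gt0; have := pos_opp b; case: (pos b) => // /posP/(_ a aG).
by rewrite coef_opp oppr_ge0 leNgt a_gt0.
Qed.

Lemma coef_lt0_neg a b : a \in Gamma -> coef a (val b) < 0 -> ~~ pos b.
Proof.
by move=> aG a_lt0; rewrite -pos_opp (coef_gt0_pos aG) // coef_opp oppr_gt0.
Qed.

Lemma pos_support1 a b : a \in Gamma -> pos b ->
  (forall c, c \in Gamma -> c != a -> coef c (val b) = 0) -> b = a.
Proof.
move=> aG bp b0; have bE : val b = coef a (val b) *: val a.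
  rewrite {1}(coef_sum (val b)) (bigD1 a) //= big1 ?addr0 // => c /andP[cG ca].
  by rewrite b0 ?scale0r.
case: (reduced bE) => // bo.
by have := bp; rewrite bo pos_opp pos_simple.
Qed.

(** A positive root other than [a] has a positive coordinate along some simple
[c <> a], which [s_ a] does not change, and one coordinate fixes the sign. *)
Lemma pos_s a b : a \in Gamma -> pos b -> b != a -> pos (s_ a b).
Proof.
move=> aG bp ba.
case: (pickP [pred c in Gamma | (c != a) && (0 < coef c (val b))]) => [c|no].
  case/and3P=> cG ca c_gt0; apply: (coef_gt0_pos cG).
  by rewrite coef_s (coef_simple c aG) (negPf ca) mulr0 subr0.
case/eqP: ba; apply: pos_support1 => // c cG ca; apply/eqP.
have := no c; rewrite /= cG ca /= lt_def (posP _ bp) // andbT.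
by move/negbFE.
Qed.

Lemma pos_s_eq a b : a \in Gamma -> b != a -> b != opp_root a ->
  pos (s_ a b) = pos b.
Proof.
move=> aG ba boa; case: (boolP (pos b)) => [bp | bn]; first exact: pos_s.
apply/negbTE; rewrite -pos_opp -weyl_opp ?s_weyl // pos_s ?pos_opp //.
by apply: contraNneq boa => <-; rewrite opp_rootK.
Qed.

Lemma simple_ip_le0 a b : a \in Gamma -> b \in Gamma -> b != a -> ip b a <= 0.
Proof.
move=> aG bG ba; have /posP/(_ a aG) := pos_s aG (pos_simple bG) ba.
rewrite coef_s !coef_simple // eqxx mulr1 eq_sym (negPf ba) sub0r oppr_ge0.
by rewrite /cartan pmulr_lle0 ?invr_gt0 ?ip_gt0 // pmulr_rle0.
Qed.

(** * Generation by the simple reflections *)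

Lemma parabolic_sub J : parabolic J \subset weyl Phi.
Proof.
by rewrite gen_subG; apply/subsetP=> _ /imsetP[a _ ->]; apply: s_weyl.
Qed.

Lemma parabolic_weyl J w : w \in parabolic J -> w \in weyl Phi.
Proof. exact: (subsetP (parabolic_sub J)). Qed.

Lemma s_parabolic J a : a \in J -> s_ a \in parabolic J.
Proof. by move=> aJ; apply/mem_gen/imset_f. Qed.

Definition height (p : V) : R := \sum_(a in Gamma) coef a p.

(** A positive root of least height among the conjugates of [b] is simple:
some simple [a] has a positive inner product with it, and [s_ a] would lower its
height without leaving the positive roots. *)
Lemma pos_conj_simple b : pos b ->
  exists2 w, w \in parabolic Gamma & w b \in Gamma.
Proof.
move=> bp; pose P c := pos c && [exists w in parabolic Gamma, w b == c].
have Pb : P b.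
  by rewrite /P bp; apply/existsP; exists 1%g; rewrite group1 perm1 eqxx.
case: (arg_minP (fun c => height (val c)) Pb) => c /andP[cp /existsP[w]].
move=> /andP[wG /eqP wb] cmin; exists w => //; rewrite wb.
have [a /andP[aG a_gt0]] : exists a, (a \in Gamma) && (0 < ip a c).
  (* Otherwise [ip c c], expanded along the simple roots, would be <= 0. *)
  apply/existsP; apply: contraTT (ip_gt0 c) => /existsPn no.
  have -> : ip c c = \sum_(a in Gamma) coef a (val c) * ip c a.
    rewrite /ip [X in rs_dot _ _ X](coef_sum (val c)) linear_sum.
    by apply: eq_bigr => a _; rewrite linearZ.
  rewrite -leNgt.
  apply: sumr_le0 => a aG; rewrite ipC mulr_ge0_le0 ?(posP _ cp) //.
  by have := no a; rewrite aG /= -leNgt.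
have [-> // | ca] := eqVneq c a.
have /cmin : P (s_ a c).
  rewrite /P pos_s //; apply/existsP; exists (w * s_ a)%g.
  by rewrite groupM ?s_parabolic // permM wb eqxx.
rewrite /height [X in _ <= X](eq_bigr _ (fun d _ => coef_s a c d)).
rewrite big_split /= lerDl sumrN oppr_ge0 -mulr_sumr leNgt.
rewrite mulr_gt0 //.
  by rewrite mulr_gt0 ?invr_gt0 ?ip_gt0 // mulr_gt0 // ipC.
rewrite (bigD1 a) //= (coef_simple a aG) eqxx ltr_wpDr ?ltr01 //.
by apply: sumr_ge0 => d /andP[dG _]; apply: (posP _ (pos_simple aG)).
Qed.

Lemma weylE : weyl Phi = parabolic Gamma.
Proof.
apply/eqP; rewrite -val_eqE eqEsubset parabolic_sub andbT gen_subG.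
apply/subsetP=> _ /imsetP[b _ ->].
wlog bp : b / pos b.
  move=> th; have [/th // | /th] := pos_or_opp b; by rewrite s_opp.
have [w wG wb] := pos_conj_simple bp.
rewrite -(groupJr _ wG) /= sJ ?(parabolic_weyl wG) //; exact: s_parabolic.
Qed.

(** * Length *)

Let S := [set s_ a | a in Gamma].
Local Notation len := (length Gamma).

Lemma expgs_weyl n w : w \in (S ^+ n)%g -> w \in weyl Phi.
Proof.
rewrite weylE; elim: n w => [|n IHn] w; first by rewrite expg0 => /set1P->.
rewrite expgS => /mulsgP[x y xS /IHn yW ->].
by rewrite groupM //; apply: mem_gen.
Qed.

(** The exchange condition. It is stated for any positive root [b]: in the
induction, moving [s_ b] past the first letter [s_ c] turns [b] into [s_ c b],
which need not be simple. *)
Lemma exchange n w b : w \in (S ^+ n)%g -> pos b -> ~~ pos (w b) ->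
  (0 < n)%N /\ (s_ b * w \in S ^+ n.-1)%g.
Proof.
elim: n w b => [|n IHn] w b.
  by rewrite expg0 => /set1P-> bp; rewrite perm1 bp.
rewrite expgS => /mulsgP[_ w' /imsetP[c cG ->] w'S ->] bp.
have [-> _ | bc] := eqVneq b c; first by rewrite mulgA s_sqr mul1g.
rewrite permM => /(IHn _ _ w'S (pos_s cG bp bc))[n_gt0 /= scS].
split=> //; rewrite -(prednK n_gt0) expgS.
have -> : (s_ b * (s_ c * w') = s_ c * (s_ (s_ c b) * w'))%g.
  by rewrite -sJ ?s_weyl // conjgE !mulgA sV s_sqr mul1g.
by rewrite mem_mulg // imset_f.
Qed.

Lemma length_mem w : w \in weyl Phi -> w \in (S ^+ len w)%g.
Proof. by rewrite weylE => /lengthP[]. Qed.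

Lemma length_min w n : w \in (S ^+ n)%g -> (len w <= n)%N.
Proof.
by move=> wn; have := expgs_weyl wn; rewrite weylE => /lengthP[_ ->].
Qed.

Lemma length_bound w : (len w <= #|weyl Phi|)%N.
Proof. by rewrite /length (leq_trans (find_size _ _)) // size_iota. Qed.

Lemma length_s_neg w a : w \in weyl Phi -> a \in Gamma -> ~~ pos (w a) ->
  len w = (len (s_ a * w)%g).+1.
Proof.
move=> wW aG wa; have [l_gt0 wS] := exchange (length_mem wW) (pos_simple aG) wa.
apply/eqP; rewrite eqn_leq -{2}(prednK l_gt0) ltnS (length_min wS) andbT.
apply: length_min; rewrite -[w in w \in _](mulKg (s_ a)) sV expgS.
by rewrite mem_mulg ?imset_f ?length_mem // groupM ?s_weyl.
Qed.

Lemma length_s_pos w a : w \in weyl Phi -> a \in Gamma -> pos (w a) ->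
  len (s_ a * w)%g = (len w).+1.
Proof.
move=> wW aG wa; rewrite (@length_s_neg _ a) ?groupM ?s_weyl //.
  by rewrite mulgA s_sqr mul1g.
by rewrite permM s_id weyl_opp // pos_opp negbK.
Qed.

Lemma lengthV w : w \in weyl Phi -> len w^-1 = len w.
Proof.
have leV n x : x \in (S ^+ n)%g -> x^-1%g \in (S ^+ n)%g.
  elim: n x => [|n IHn] x.
    by rewrite expg0 => /set1P->; rewrite invg1 set11.
  rewrite expgSr => /mulsgP[y _ yS /imsetP[a aG ->] ->].
  by rewrite invMg sV -expgSr expgS mem_mulg ?imset_f ?IHn.
move=> wW; apply/eqP; rewrite eqn_leq !length_min ?leV ?length_mem //.
by rewrite -[w in w \in _]invgK leV // length_mem ?groupV.
Qed.

Lemma length_s_geq w a : w \in weyl Phi -> a \in Gamma ->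
  (len w <= (len (s_ a * w)%g).+1)%N.
Proof.
move=> wW aG; have [wa | wa] := boolP (pos (w a)).
  by rewrite length_s_pos // ltnW.
by rewrite (length_s_neg wW aG wa).
Qed.

(** If [w] were not [1], the first letter [s_ a] of a shortest word for [w]
would satisfy [length (s_ a * w) < length w], whence [w a < 0]. *)
Lemma pos_eq1 w : w \in weyl Phi -> (forall a, a \in Gamma -> pos (w a)) ->
  w = 1%g.
Proof.
move=> wW wp; have := length_mem wW.
case l: (len w) => [|n]; first by rewrite expg0 => /set1P.
rewrite expgS => /mulsgP[_ w' /imsetP[a aG ->] w'S wE].
have := length_s_pos wW aG (wp a aG); rewrite wE mulgA s_sqr mul1g -wE l.
by move=> w'l; have := length_min w'S; rewrite w'l ltnNge ltnW.
Qed.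

(** * Parabolic subgroups and their longest elements *)

Definition in_span J b := [forall c in Gamma :\: J, coef c (val b) == 0].

Lemma coef_parabolic J g b c : J \subset Gamma -> g \in parabolic J ->
  c \in Gamma :\: J -> coef c (val (g b)) = coef c (val b).
Proof.
move=> JG gJ /setDP[cG cJ].
move: g gJ b; apply: gen_ind => [|x y /imsetP[a aJ ->] _ IH] b.
  by rewrite perm1.
have aG := subsetP JG a aJ.
have /negPf ca : c != a by apply: contraNneq cJ => ->.
by rewrite permM IH coef_s (coef_simple c aG) ca mulr0 subr0.
Qed.

Lemma pos_parabolic J g c : J \subset Gamma -> g \in parabolic J ->
  c \in Gamma :\: J -> pos (g c).
Proof.
move=> JG gJ cJ; have /setDP[cG _] := cJ; apply: (coef_gt0_pos cG).
by rewrite (coef_parabolic _ JG gJ cJ) coef_simple // eqxx ltr01.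
Qed.

Lemma longest_mem J : longest Gamma J \in parabolic J.
Proof. by rewrite /longest; case: arg_maxnP. Qed.

Lemma longest_neg J a : J \subset Gamma -> a \in J ->
  ~~ pos (longest Gamma J a).
Proof.
move=> JG aJ; have aG := subsetP JG a aJ.
have wJ := longest_mem J; have wW := parabolic_weyl wJ.
apply/negP=> /(length_s_pos wW aG).
move: wJ; rewrite /longest; case: arg_maxnP => // w _ wmax wJ l.
have := wmax _ (groupM (s_parabolic aJ) wJ).
by rewrite /= l ltnn.
Qed.

Lemma in_span_neg J f b : J \subset Gamma -> in_span J b -> pos b ->
  f \in weyl Phi -> (forall a, a \in J -> ~~ pos (f a)) -> ~~ pos (f b).
Proof.
move=> JG bJ bp fW fneg; rewrite -pos_opp; apply/posP=> c cG.
have [F FE] := weyl_linear fW.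
rewrite coef_opp FE (coef_sum (val b)) linear_sum linear_sum -sumrN.
apply: sumr_ge0 => a aG; rewrite !linearZ /= -FE -mulrN -coef_opp.
have [aJ|aJ] := boolP (a \in J).
  have /posP fa : pos (opp_root (f a)) by rewrite pos_opp fneg.
  by rewrite mulr_ge0 ?(posP _ bp) ?fa.
by rewrite (eqP (forall_inP bJ a _)) ?mul0r // inE aJ.
Qed.

Lemma in_span_simple J a : J \subset Gamma -> a \in J -> in_span J a.
Proof.
move=> JG aJ; apply/forall_inP=> c /setDP[cG cJ]; rewrite coef_simple.
  by have /negPf-> : c != a by apply: contraNneq cJ => ->.
exact: (subsetP JG).
Qed.

Lemma in_span_parabolic J g b : J \subset Gamma -> g \in parabolic J ->
  in_span J (g b) = in_span J b.
Proof.
move=> JG gJ; apply: eq_forallb_in => c cJ.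
by rewrite (coef_parabolic _ JG gJ cJ).
Qed.

Lemma in_span_opp J b : in_span J (opp_root b) = in_span J b.
Proof. by apply: eq_forallb_in => c cJ; rewrite coef_opp oppr_eq0. Qed.

(** The product sends [J] to positive roots, as negative roots in the span of
[J] become positive under [h]; the simple roots outside [J] stay positive under
all of [parabolic J]. So the product is [1]. With [h = g] this shows that the
longest element is an involution. *)
Lemma longest_unique J g h : J \subset Gamma -> g \in parabolic J ->
  h \in parabolic J -> (forall a, a \in J -> ~~ pos (g a)) ->
  (forall a, a \in J -> ~~ pos (h a)) -> (g * h = 1)%g.
Proof.
move=> JG gJ hJ gneg hneg; have hW := parabolic_weyl hJ.
apply: pos_eq1 => [|a aG]; first by rewrite groupM // (parabolic_weyl gJ).
have [aJ | aJ] := boolP (a \in J); last first.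
  by apply: (pos_parabolic JG (groupM gJ hJ)); rewrite inE aJ.
rewrite permM -[g a]opp_rootK weyl_opp // pos_opp.
apply: (in_span_neg JG) => //; last by rewrite pos_opp gneg.
by rewrite in_span_opp in_span_parabolic // in_span_simple.
Qed.

Lemma longest_sqr J : J \subset Gamma ->
  (longest Gamma J * longest Gamma J = 1)%g.
Proof.
by move=> JG; apply: (longest_unique JG); rewrite ?longest_mem // => a;
  apply: longest_neg.
Qed.

Lemma w0E : w0 Gamma = longest Gamma Gamma.
Proof. by rewrite /w0 weylE. Qed.

Lemma w0_weyl : w0 Gamma \in weyl Phi.
Proof. by rewrite w0E (parabolic_weyl (longest_mem _)). Qed.

Lemma longest_weyl J : longest Gamma J \in weyl Phi.
Proof. exact: parabolic_weyl (longest_mem J). Qed.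

Lemma w0K b : w0 Gamma (w0 Gamma b) = b.
Proof. by rewrite -permM w0E longest_sqr // perm1. Qed.

Lemma pos_w0 b : pos (w0 Gamma b) = ~~ pos b.
Proof.
have neg c : pos c -> ~~ pos (w0 Gamma c).
  move=> cp; apply: (@in_span_neg Gamma) => //; last 1 first.
  - by rewrite w0E => a; apply: longest_neg.
  - by apply/forall_inP=> d; rewrite setDv inE.
  - exact: w0_weyl.
apply/idP/idP=> [|bn]; first by apply: contraTN => /neg.
by rewrite -[b]opp_rootK weyl_opp ?w0_weyl // pos_opp neg // pos_opp.
Qed.

(** * The opposition involution *)

Lemma w0_unique w : w \in weyl Phi -> (forall a, a \in Gamma -> ~~ pos (w a)) ->
  w = w0 Gamma.
Proof.
move=> wW wneg; have sGG := subxx Gamma.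
have e : (w * w0 Gamma = 1)%g.
  apply: (longest_unique sGG) => //; rewrite -?weylE ?w0_weyl // => a aG.
  by rewrite pos_w0 pos_simple.
by apply/permP=> b; rewrite -[w b]w0K -(permM w) e perm1.
Qed.

Local Notation delta := (delta0 Gamma).

Lemma delta0K : involutive delta.
Proof.
by move=> b; rewrite /delta0 weyl_opp ?w0_weyl // w0K opp_rootK.
Qed.

Lemma pos_delta0 b : pos (delta b) = pos b.
Proof. by rewrite pos_opp pos_w0 negbK. Qed.

(** Expand [delta a] along the simple roots and apply [delta]: the root [a] is
then a combination of positive roots [delta c] with coefficients >= 0, so each
[delta c] that occurs is proportional to [a], thus equal to it. *)
Lemma delta0_simple a : a \in Gamma -> delta a \in Gamma.
Proof.
move=> aG; have [F FE] := weyl_linear w0_weyl.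
have dp : pos (delta a) by rewrite pos_delta0 pos_simple.
have [c cG c_gt0] := pos_ex dp.
suff <- : c = delta a by [].
apply: (can_inj delta0K); rewrite delta0K.
have dcp : pos (delta c) by rewrite pos_delta0 pos_simple.
apply: pos_support1 => // d dG da.
have : \sum_(e in Gamma) coef e (val (delta a)) * coef d (val (delta e)) = 0.
  transitivity (coef d (val a)); last by rewrite coef_simple // (negPf da).
  have -> : val a = - F (val (delta a)) by rewrite -{1}(delta0K a) -FE.
  rewrite [in RHS](coef_sum (val (delta a))) !linear_sum.
  apply: eq_bigr => e _; rewrite /=; set t := coef e _.
  have -> : - F (t *: val e) = t *: val (delta e).
    by rewrite linearZ /= -FE scalerN.
  by rewrite linearZ.
have nneg e : e \in Gamma ->
    0 <= coef e (val (delta a)) * coef d (val (delta e)).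
  move=> eG; rewrite mulr_ge0 ?(posP _ dp) //.
  by have /posP-> : pos (delta e) by rewrite pos_delta0 pos_simple.
move/(psumr_eq0P nneg)/(_ c cG)/eqP; rewrite mulf_eq0 gt_eqF //=.
by move/eqP.
Qed.

(** * Terminal elements *)

(** The condition is relative to [I] because climbing is also studied inside
the rank two parabolic subgroups. *)
Definition terminal I w := [forall a in I, pos (w a) ==> (w a == a)].

Lemma terminalP I w :
  reflect (forall a, a \in I -> pos (w a) -> w a = a) (terminal I w).
Proof.
apply: (iffP forall_inP) => h a aI; first by move/(implyP (h a aI))/eqP.
by apply/implyP=> /(h a aI)/eqP.
Qed.

Lemma fix_in_span J (F : 'End(V)) p :
  (forall a, a \in J -> F (val a) = val a) ->
  (forall c, c \in Gamma :\: J -> coef c p = 0) -> F p = p.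
Proof.
move=> FJ p0; rewrite {1}(coef_sum p) linear_sum [RHS]coef_sum.
apply: eq_bigr => a aG; rewrite linearZ /=.
have [aJ | aJ] := boolP (a \in J); first by rewrite FJ.
by rewrite p0 ?scale0r // inE aJ.
Qed.

Lemma J_sub m : J_ Gamma m \subset Gamma.
Proof. by apply/subsetP=> a; rewrite inE => /andP[]. Qed.

(** Let [y] be [m] after the longest element [w] of [W_J]. For [a] in [J], the
root [w a] is a negative root in the span of [J], where [m] is the identity. For
[a] outside [J], [m a] is negative and not in the span of [J], otherwise [m]
would fix [m a], hence [a]; as [m (w a)] differs from [m a] by a vector in that
span, it is negative too. So [y = w0]. *)
Lemma terminal_eq m : m \in weyl Phi -> terminal Gamma m ->
  m_ Gamma (J_ Gamma m) = m.
Proof.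
move=> mW /terminalP mt; set J := J_ Gamma m.
have JG : J \subset Gamma := J_sub m.
have [F FE] := weyl_linear mW.
have FJ a : a \in J -> F (val a) = val a.
  by rewrite -FE inE => /andP[_ /eqP->].
have wJm := longest_mem J.
rewrite /m_; suff <- : (longest Gamma J * m)%g = w0 Gamma.
  by rewrite mulgA longest_sqr // mul1g.
apply: w0_unique => [|a aG]; first by rewrite groupM ?longest_weyl.
rewrite permM; have [aJ | aJ] := boolP (a \in J).
  suff -> : m (longest Gamma J a) = longest Gamma J a by exact: longest_neg.
  apply: val_inj; rewrite FE; apply: (fix_in_span FJ) => c cJ; apply/eqP.
  have sp : in_span J (longest Gamma J a).
    by rewrite in_span_parabolic ?in_span_simple.
  exact: (forall_inP sp).
have mneg : ~~ pos (m a).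
  by apply: contra aJ => /(mt a aG) e; rewrite inE aG e eqxx.
have [c cJ c_lt0] : exists2 c, c \in Gamma :\: J & coef c (val (m a)) < 0.
  apply/exists_inP; apply: contraR aJ => /exists_inPn no.
  suff e : m a = a by rewrite inE aG e eqxx.
  apply: (@perm_inj _ m); apply: val_inj; rewrite FE.
  apply: (fix_in_span FJ) => c cJ; apply/eqP.
  have := no c cJ; rewrite -leNgt le_eqVlt eq_sym => /orP[// | c_gt0].
  have /setDP[cG _] := cJ.
  by case/negP: mneg; apply: coef_gt0_pos cG c_gt0.
have /setDP[cG _] := cJ; apply: (coef_lt0_neg cG).
have e : F (val (longest Gamma J a) - val a) = val (longest Gamma J a) - val a.
  apply: (fix_in_span FJ) => d dJ.
  by rewrite linearB /= (coef_parabolic _ JG wJm dJ) subrr.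
rewrite FE -[val (longest _ _ _)](subrK (val a)) linearD /= e -FE.
by rewrite linearD linearB /= (coef_parabolic _ JG wJm cJ) subrr add0r.
Qed.

Lemma m_weyl J : m_ Gamma J \in weyl Phi.
Proof. by rewrite groupM ?longest_weyl ?w0_weyl. Qed.

(** [m = m_J] fixes [J] pointwise, which says that [w0] and the longest element
of [W_J] agree on [J]; hence [delta] maps [J] to simple roots in the span of
[J], that is, to [J]. *)
Lemma terminal_property1 m : m \in weyl Phi -> terminal Gamma m ->
  property1 Gamma (J_ Gamma m).
Proof.
move=> mW mt; have mE := terminal_eq mW mt; set J := J_ Gamma m in mE *.
have JG : J \subset Gamma := J_sub m.
have w0J a : a \in J -> w0 Gamma a = longest Gamma J a.
  by rewrite inE -{1}mE permM => /andP[_ /eqP e]; rewrite -{1}e w0K.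
have dJ a : a \in J -> delta a \in J.
  move=> aJ; have aG := subsetP JG a aJ; apply/negPn/negP=> daJ.
  have := in_span_simple JG aJ.
  rewrite -(in_span_parabolic _ JG (longest_mem J)) -w0J // -in_span_opp.
  move/forall_inP/(_ (delta a)); rewrite inE daJ delta0_simple // => /(_ isT).
  by rewrite coef_simple ?delta0_simple // eqxx oner_eq0.
apply/andP; split; last by apply/forall_inP=> a /w0J->.
rewrite eqEcard card_imset ?leqnn ?andbT; last exact: can_inj delta0K.
by apply/subsetP=> _ /imsetP[a aJ ->]; apply: dJ.
Qed.

(** * Lengths of conjugates by simple reflections *)

Lemma length_sr_geq w a : w \in weyl Phi -> a \in Gamma ->
  (len w <= (len (w * s_ a)%g).+1)%N.
Proof.
move=> wW aG; have := length_s_geq (groupVr wW) aG.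
rewrite -(lengthV (groupM (s_weyl a) (groupVr wW))) invMg invgK sV.
by rewrite (lengthV wW).
Qed.

Lemma conj_sE w a : (w ^ s_ a = s_ a * w * s_ a)%g.
Proof. by rewrite conjgE sV mulgA. Qed.

Lemma length_conj_geq w a : w \in weyl Phi -> a \in Gamma ->
  (len w <= (len (w ^ s_ a)%g).+2)%N.
Proof.
move=> wW aG; rewrite conj_sE (leq_trans (length_s_geq wW aG)) // ltnS.
by rewrite length_sr_geq // groupM ?s_weyl.
Qed.

Lemma length_conj_pos w a : w \in weyl Phi -> a \in Gamma -> pos (w a) ->
  (len w <= len (w ^ s_ a)%g)%N.
Proof.
move=> wW aG wa; rewrite conj_sE -ltnS -(length_s_pos wW aG wa).
by rewrite length_sr_geq // groupM ?s_weyl.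
Qed.

Lemma length_conj_up w a : w \in weyl Phi -> a \in Gamma -> pos (w a) ->
  pos ((w^-1)%g a) -> w a != a -> len (w ^ s_ a)%g = (len w).+2.
Proof.
move=> wW aG wa wVa ne; have sW := s_weyl a; rewrite conj_sE.
rewrite -(lengthV (groupM (groupM sW wW) sW)) invMg sV length_s_pos //.
- by rewrite lengthV ?groupM // length_s_pos.
- by rewrite groupV groupM.
rewrite invMg sV permM pos_s // -(inj_eq (@perm_inj _ w)) permKV eq_sym.
exact: ne.
Qed.

(** If [m a > 0], then [m ^ s_ a] is not shorter than [m], so it is [m]; as
[m] commutes with [s_ a], the positive root [m a] becomes negative under [s_ a],
which happens only to [a]. *)
Lemma calM_terminal m : m \in calM Gamma -> m \in weyl Phi /\ terminal Gamma m.
Proof.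
rewrite inE => /andP[mW /forall_inP mmax]; split=> //.
apply/terminalP=> a aG ma.
have cm : (m ^ s_ a)%g = m.
  apply/eqP/negPn/negP=> ne.
  have /implyP/(_ ne) := mmax _ (memJ_class m (s_weyl a)).
  by rewrite ltnNge length_conj_pos.
have e : s_ a (m a) = opp_root (m a).
  by rewrite -permM -[in RHS](weyl_opp _ mW) -s_id -permM -[in LHS]cm
    conj_sE -!mulgA s_sqr mulg1.
apply/eqP/negPn/negP=> ne.
by have := pos_s aG ma ne; rewrite e pos_opp ma.
Qed.

(** * Maximal elements have property (2) *)

Lemma cartan_lt0 b a : ip b a < 0 -> cartan b a <= -1.
Proof.
move=> ba_lt0; have := cartanM b a; have [z ->] := cartan_int b a => zE.
have z_lt0 : z < 0.
  by rewrite -(ltrz0 R) -(pmulr_llt0 _ (ip_gt0 a)) zE pmulr_rlt0.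
have : z <= -1 by lia.
by rewrite -(ler_int R).
Qed.

(** The coefficient is a negative integer, and it is greater than [-2] because
the square norm of [a + b] is positive. *)
Lemma cartan_A2 a b : a \in Gamma -> b \in Gamma -> a != b ->
  ip a a = ip b b -> ip b a != 0 -> cartan b a = -1.
Proof.
move=> aG bG ab eq_len ne.
have := cartanM b a; have : cartan b a <= -1.
  by rewrite cartan_lt0 // lt_neqAle ne simple_ip_le0 // eq_sym.
have [z ->] := cartan_int b a => z_le e.
have {}z_le : z <= -1 by move: z_le; rewrite -(ler_int R).
have z_gtN2 : -2 < z.
  have p_neq0 : val a + val b != 0.
    apply/eqP=> /(congr1 (coef a)); rewrite linearD linear0 /= !coef_simple //.
    by rewrite eqxx (negPf ab) addr0 => /eqP; rewrite oner_eq0.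
  have : 0 < rs_dot Phi (val a + val b) (val a + val b).
    exact: neq0_dnorm_gt0.
  rewrite linearD /= !linearDl /= -!/(ip _ _) -eq_len [ip a b]ipC.
  rewrite -(ltr_int R) => p_gt0; rewrite -(ltr_pM2r (ip_gt0 a)) e.
  by move: p_gt0; lra.
by have -> : z = -1 by lia.
Qed.

Lemma s_A2 a b : a \in Gamma -> b \in Gamma -> a != b ->
  ip a a = ip b b -> ip b a != 0 -> s_ a b = s_ b a.
Proof.
move=> aG bG ab eq_len ne; have eb : cartan b a = -1 by exact: cartan_A2.
have ea : cartan a b = -1 by apply: cartan_A2; rewrite // 1?ipC // eq_sym.
by apply: val_inj; rewrite !sE eb ea !scaleN1r !opprK addrC.
Qed.

(** If [a] and [b] contradict property (2), then [m a = a] and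
[m b = - (a + b)]. The conjugate [x] of [m] by [s_ b] exchanges [a] and [b], so
conjugating [x] by [s_ a] adds 2 to its length. The result is at least as long
as [m], and it differs from [m] since it fixes [b]. *)
Lemma calM_property2 m : m \in calM Gamma -> property2 Gamma (J_ Gamma m).
Proof.
move=> mM; have [mW mt] := calM_terminal mM.
have mE := terminal_eq mW mt; have := terminal_property1 mW mt.
set J := J_ Gamma m in mE *; have JG : J \subset Gamma := J_sub m.
have mJ a : a \in J -> m a = a by rewrite inE => /andP[_ /eqP].
clearbody J; case/andP=> /eqP dJ /forall_inP w0J.
apply/forall_inP=> a /andP[aJ /forall_inP iso]; apply/negP=> /exists_inP[b].
case/setD1P=> ba bG /and4P[/eqP eq_len ne /forall_inP orth /eqP db].
have aG := subsetP JG a aJ; have ma := mJ a aJ.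
have ab : a != b by rewrite eq_sym.
have bJ : b \notin J.
  by apply: contra ne => bJ; rewrite ipC iso // !inE ba bJ.
have daJ : delta a \in J by rewrite -dJ imset_f.
have w0W := w0_weyl; have daG := delta0_simple aG.
have da : delta a = a.
  apply/eqP; apply: contraNT ne => da.
  have := orth (delta a); rewrite !inE da daJ => /(_ isT).
  by rewrite -{1}db /delta0 ip_oppl ip_oppr opprK ip_weyl.
(* Within W_J only [s_ a] moves [b] or [s_ a b], and it exchanges them. *)
have wJb : longest Gamma J b = s_ a b.
  have /set2P[bE|//] : longest Gamma J b \in [set b; s_ a b].
    move: (longest Gamma J) (longest_mem J) => g gJ.
    suff : forall c, c \in [set b; s_ a b] -> g c \in [set b; s_ a b].
      by apply; rewrite set21.
    move: g gJ; apply: gen_ind => [c|x y /imsetP[d dJ' ->] _ IH c].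
      by rewrite perm1.
    move=> cB; rewrite permM; apply: IH.
    have [-> | nda] := eqVneq d a.
      by case/set2P: cB => ->; rewrite ?sK !inE eqxx ?orbT.
    suff -> : s_ d c = c by [].
    apply: val_inj; rewrite sE /cartan.
    have dJa : d \in J :\ a by rewrite !inE nda.
    have -> : ip c d = 0.
      case/set2P: cB => ->; rewrite ?ip_sl (eqP (orth d dJa)) //.
      by rewrite (eqP (iso d dJa)) mulr0 subr0.
    by rewrite mulr0 mul0r scale0r subr0.
  (* As w_J maps [a] to [- a], fixing [b] would force [ip b a >= 0]. *)
  have := simple_ip_le0 aG bG ba; rewrite -(ip_weyl _ _ (longest_weyl J)) bE.
  rewrite -[longest _ _ a]opp_rootK -(eqP (w0J a aJ)) -/(delta0 _ a) da.
  rewrite ip_oppr oppr_le0 => ba_ge0.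
  have := simple_ip_le0 aG bG ba; rewrite le_eqVlt (negPf ne) /=.
  by rewrite ltNge ba_ge0.
have sab : s_ a b = s_ b a by apply: s_A2.
have mb : m b = opp_root (s_ a b).
  rewrite -mE permM wJb weyl_s //.
  have -> : w0 Gamma a = opp_root a.
    by rewrite -[w0 _ a]opp_rootK -/(delta a) da.
  have -> : w0 Gamma b = opp_root b by rewrite -[w0 _ b]opp_rootK db.
  by rewrite s_opp weyl_opp ?s_weyl.
set x := (m ^ s_ b)%g; have xW : x \in weyl Phi by rewrite groupJ ?s_weyl.
have xE c : x c = s_ b (m (s_ b c)) by rewrite /x conj_sE !permM.
have xa : x a = b.
  by rewrite xE -sab weyl_s // ma mb weyl_opp ?s_weyl // sK weyl_opp ?s_weyl //
    s_id opp_rootK.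
have xb : x b = a.
  by rewrite xE s_id weyl_opp // mb opp_rootK sab sK.
have xVa : (x^-1)%g a = b by rewrite -xb permK.
have xlen : len (x ^ s_ a)%g = (len x).+2.
  by apply: length_conj_up; rewrite ?xa ?xVa ?pos_simple.
have mlen : (len m <= len (x ^ s_ a)%g)%N by rewrite xlen length_conj_geq.
have : (x ^ s_ a)%g = m.
  apply/eqP/negPn/negP=> xm; move: mM; rewrite inE => /andP[_ /forall_inP].
  move/(_ (x ^ s_ a)%g); rewrite xm ltnNge mlen /x -conjgM memJ_class //.
    by move/(_ isT).
  by rewrite groupM ?s_weyl.
clearbody x; move/(congr1 (fun w : {perm _} => w b)).
rewrite /= mb conj_sE !permM sab (weyl_s _ _ xW) xa xb -sab sK => e.
have := pos_simple bG; rewrite e pos_opp sab pos_s // pos_simple //.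
Qed.

(** * The involution attached to a set with property (1) *)

Lemma m_fix J a : property1 Gamma J -> a \in J -> m_ Gamma J a = a.
Proof.
case/andP=> _ /forall_inP w0J aJ; rewrite permM.
by rewrite -[longest _ _ a]opp_rootK -(eqP (w0J a aJ)) opp_rootK w0K.
Qed.

Lemma m_neg J a : J \subset Gamma -> a \in Gamma :\: J -> ~~ pos (m_ Gamma J a).
Proof.
move=> JG aJ.
by rewrite permM pos_w0 negbK (pos_parabolic JG (longest_mem J) aJ).
Qed.

Lemma m_terminal J : J \subset Gamma -> property1 Gamma J ->
  terminal Gamma (m_ Gamma J).
Proof.
move=> JG J1; apply/terminalP=> a aG ma; apply: m_fix => //.
by apply: contraTT ma => aJ; rewrite m_neg // inE aJ.
Qed.

Lemma J_mK J : J \subset Gamma -> property1 Gamma J ->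
  J_ Gamma (m_ Gamma J) = J.
Proof.
move=> JG J1; apply/setP=> a; rewrite inE.
apply/andP/idP=> [[aG ma] | aJ]; last by rewrite m_fix ?(subsetP JG).
apply: contraLR (pos_simple aG) => aJ; rewrite -(eqP ma) m_neg // inE aJ //.
Qed.

Lemma property1_delta J a : property1 Gamma J -> (delta a \in J) = (a \in J).
Proof.
case/andP=> /eqP dJ _; rewrite -{1}dJ mem_imset //; exact: can_inj delta0K.
Qed.

Definition involution x := (x \in weyl Phi) && (x * x == 1)%g.

Lemma involutionV x : involution x -> (x^-1)%g = x.
Proof. by case/andP=> _ xx; apply/eqP; rewrite eq_invg_mul. Qed.

Lemma involutionK x a : involution x -> x (x a) = a.
Proof. by case/andP=> _ /eqP xx; rewrite -permM xx perm1. Qed.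

Lemma involution_weyl x : involution x -> x \in weyl Phi.
Proof. by case/andP. Qed.

Lemma involution_conj x u : u \in weyl Phi -> involution x ->
  involution (x ^ u)%g.
Proof.
move=> uW /andP[xW /eqP xx].
by rewrite /involution groupJ // -conjMg xx conj1g eqxx.
Qed.

(** The inverse of [m_J] is terminal with the same fixed simple roots, since
[delta] preserves the complement of [J]; a terminal element is determined by its
fixed simple roots. *)
Lemma m_involution J : J \subset Gamma -> property1 Gamma J ->
  involution (m_ Gamma J).
Proof.
move=> JG J1; set m := m_ Gamma J; have mW : m \in weyl Phi := m_weyl J.
have mVE : (m^-1 = w0 Gamma * longest Gamma J)%g.
  have w0w0 : (w0 Gamma * w0 Gamma = 1)%g by rewrite w0E longest_sqr.
  apply/eqP; rewrite eq_invg_mul /m /m_ mulgA -(mulgA (longest _ _)) w0w0.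
  by rewrite mulg1 longest_sqr.
have fixV a : ((m^-1)%g a == a) = (m a == a).
  by rewrite -(inj_eq (@perm_inj _ m)) permKV eq_sym.
have JV : J_ Gamma (m^-1)%g = J.
  by rewrite -[RHS](J_mK JG J1); apply/setP=> a; rewrite !inE fixV.
have tV : terminal Gamma (m^-1)%g.
  apply/terminalP=> a aG maV; apply/eqP; rewrite fixV.
  have [aJ | aJ] := boolP (a \in J); first by rewrite /m m_fix.
  case/negP: (isT); move: maV; rewrite mVE permM -[w0 _ a]opp_rootK.
  rewrite weyl_opp ?longest_weyl // pos_opp -/(delta0 _ a).
  rewrite (pos_parabolic JG (longest_mem J)) //.
  by rewrite inE property1_delta // aJ delta0_simple.
rewrite /involution mW /=; have := terminal_eq (groupVr mW) tV.
by rewrite JV -/m => e; rewrite -eq_invg_mul -e eqxx.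
Qed.

(** * Climbing in a class of involutions *)

(** For an involution [x], these are the simple roots [a] such that conjugation
by [s_ a] lengthens [x]. *)
Definition up x a := [&& a \in Gamma, pos (x a) & x a != a].

Definition climb x y := [exists a, up x a && (y == (x ^ s_ a)%g)].

Lemma length_up x a : involution x -> up x a -> len (x ^ s_ a)%g = (len x).+2.
Proof.
move=> xI /and3P[aG xa ne]; apply: length_conj_up => //.
  exact: involution_weyl.
by rewrite involutionV.
Qed.

Lemma climb_up x a : up x a -> connect climb x (x ^ s_ a)%g.
Proof. by move=> xa; apply/connect1/existsP; exists a; rewrite xa eqxx. Qed.

Lemma connect_climb x y : connect climb x y ->
  x = y \/ exists2 a, up x a & connect climb (x ^ s_ a)%g y.
Proof.
case/connectP=> [[|z p] /= ]; first by move=> _ ->; left.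
case/andP=> /existsP[a /andP[xa /eqP zE]] zp ->; right; exists a => //.
by rewrite -zE; apply/connectP; exists p.
Qed.

Lemma terminal_up I x : I \subset Gamma ->
  terminal I x = [forall a in I, ~~ up x a].
Proof.
move=> IG; apply: eq_forallb_in => a aI.
by rewrite /up (subsetP IG) //= negb_and negbK implybE.
Qed.

Lemma terminal_connect x y : terminal Gamma x -> connect climb x y -> y = x.
Proof.
rewrite terminal_up // => /forall_inP xt /connect_climb[// | [a xa _]].
by have /negP[] := xt a (andP xa).1.
Qed.

Lemma connect_length x y : involution x -> connect climb x y ->
  y = x \/ (len x < len y)%N.
Proof.
move=> xI /connectP[p]; elim: p x xI => [|z p IHp] x xI /=.
  by move=> _ ->; left.
case/andP=> /existsP[a /andP[xa /eqP ->]] zp yE; right.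
have := length_up xI xa.
case: (IHp _ (involution_conj (s_weyl a) xI) zp yE) => [-> -> //|lt e].
by apply: ltn_trans lt; rewrite e.
Qed.

(** Climbs along [I] strictly increase the length, which is bounded. *)
Lemma climb_top I x : I \subset Gamma -> involution x ->
  exists2 u, u \in parabolic I &
    connect climb x (x ^ u)%g && terminal I (x ^ u)%g.
Proof.
move=> IG; have [n] := ubnP (#|weyl Phi| - len x).
elim: n x => // n IHn x ltn xI.
case: (boolP (terminal I x)) => [xt | ].
  by exists 1%g; rewrite ?group1 // conjg1 connect0.
rewrite terminal_up // => /forall_inPn[a aI /negPn xa].
have xaI := involution_conj (s_weyl a) xI.
have [||u uI /andP[cu tu]] := IHn (x ^ s_ a)%g => //.
  have := length_bound (x ^ s_ a)%g; rewrite length_up //; lia.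
exists (s_ a * u)%g; first by rewrite groupM ?s_parabolic.
by rewrite conjgM tu andbT (connect_trans (climb_up xa)).
Qed.

Lemma in_span_pos J f b : J \subset Gamma -> in_span J b -> pos b ->
  f \in weyl Phi -> (forall a, a \in J -> pos (f a)) -> pos (f b).
Proof.
move=> JG bJ bp fW fpos.
rewrite -[pos _]negbK -pos_w0 -permM; apply: (in_span_neg JG) => //.
  by rewrite groupM ?w0_weyl.
by move=> a aJ; rewrite permM pos_w0 fpos.
Qed.

(** The coordinates outside [J] of [w b] are sums of non-negative terms, one
for each root of [J] that occurs in [b]; they vanish only if each term does. *)
Lemma in_span_image J w b c : J \subset Gamma -> w \in weyl Phi ->
  (forall a, a \in J -> pos (w a)) -> pos b -> in_span J b -> in_span J (w b) ->
  c \in J -> 0 < coef c (val b) -> in_span J (w c).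
Proof.
move=> JG wW wpos bp /forall_inP bJ wbJ cJ c_gt0; have [F FE] := weyl_linear wW.
apply/forall_inP=> d dJ; have /setDP[dG _] := dJ.
have /eqP := forall_inP wbJ d dJ; rewrite FE (coef_sum (val b)) !linear_sum /=.
rewrite (eq_bigr (fun a => coef a (val b) * coef d (val (w a)))); last first.
  by move=> a _; rewrite linearZ /= linearZ /= FE.
have nneg a : a \in Gamma -> 0 <= coef a (val b) * coef d (val (w a)).
  move=> aG; have [aJ | aJ] := boolP (a \in J).
    by rewrite mulr_ge0 ?(posP _ bp) ?(posP _ (wpos a aJ)).
  have /eqP-> : coef a (val b) == 0 by rewrite bJ // inE aJ.
  by rewrite mul0r.
move/(psumr_eq0P nneg)/(_ c (subsetP JG c cJ))/eqP.
by rewrite mulf_eq0 gt_eqF.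
Qed.

(** * Local confluence *)

Lemma up_pair x a b : up x a -> up x b ->
  [set a; b] \subset Gamma /\ (forall c, c \in [set a; b] -> pos (x c)).
Proof.
case/and3P=> aG xa _ /and3P[bG xb _].
by split=> [|c /set2P[] -> //]; apply/subsetP=> c /set2P[] ->.
Qed.

(** Write [x a = p a + q b] with [p, q >= 0]; here [q > 0], as otherwise
[x a = a]. The coordinate along [b] of [x (x a) = a] is [q] times the sum of [p]
and of the coordinate of [x b] along [b], so that [p = 0]. *)
Lemma in_span_swap x a b : involution x -> up x a -> up x b ->
  in_span [set a; b] (x a) -> x a = b.
Proof.
move=> xI xa xb xaJ; have [F FE] := weyl_linear (involution_weyl xI).
have [/and3P[aG xap xa_neq] /and3P[bG xbp _]] := (xa, xb).
have [ab | ab] := eqVneq a b.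
  rewrite -ab; apply: pos_support1 => // c cG ca; apply/eqP.
  by apply: (forall_inP xaJ); rewrite !inE -ab (negPf ca).
have supp c : c \in Gamma -> c != a -> c != b -> coef c (val (x a)) = 0.
  move=> cG ca cb; apply/eqP; apply: (forall_inP xaJ).
  by rewrite !inE (negPf ca) (negPf cb).
have q_gt0 : 0 < coef b (val (x a)).
  rewrite lt_def (posP _ xap) // andbT.
  apply: contra_neq xa_neq => q0; apply: pos_support1 => // c cG ca.
  by have [-> // | cb] := eqVneq c b; apply: supp.
have xaE : val (x a) =
    coef a (val (x a)) *: val a + coef b (val (x a)) *: val b.
  rewrite {1}(coef_sum (val (x a))) (bigD1 a) //= (bigD1 b) /=; last first.
    by rewrite bG eq_sym.
  rewrite big1 ?addr0 // => c /andP[/andP[cG ca] cb].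
  by rewrite supp ?scale0r.
have : coef b (val (x (x a))) = 0.
  by rewrite involutionK // coef_simple // eq_sym (negPf ab).
rewrite FE {1}xaE linearD !linearZ /= -!FE linearD !linearZ /=.
rewrite mulrC -mulrDr => /eqP; rewrite mulf_eq0 gt_eqF //= addr_eq0 => /eqP p0.
apply: pos_support1 => // c cG cb.
have [-> | ca] := eqVneq c a; last exact: supp.
apply/eqP; rewrite eq_le (posP _ xap) // andbT p0 oppr_le0.
exact: (posP _ xbp).
Qed.

Lemma in_span_sep x a b r : involution x -> up x a -> up x b -> x a != b ->
  in_span [set a; b] r -> pos r -> ~~ in_span [set a; b] (x r).
Proof.
move=> xI xa xb ne rJ rp; apply/negP=> xrJ; have [JG xJ] := up_pair xa xb.
have [c cG c_gt0] := pos_ex rp.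
have cJ : c \in [set a; b].
  apply: contraLR c_gt0 => cJ.
  by rewrite (eqP (forall_inP rJ c _)) ?ltxx // inE cJ.
have := in_span_image JG (involution_weyl xI) xJ rp rJ xrJ cJ c_gt0.
case/set2P: cJ => ->; first by move/(in_span_swap xI xa xb)/eqP; apply/negP.
rewrite setUC => /(in_span_swap xI xb xa) e.
by case/eqP: ne; rewrite -e involutionK.
Qed.

(** If [r = u^-1 c] were positive, [x r] would be positive with support outside
[a] and [b], a property that [u] preserves; then [(x ^ u) c = u (x r)] would be
positive without being [c]. Hence [u^-1], and so [u], is the longest element of
the dihedral group. *)
Lemma terminal_conj_neg x a b u c : involution x -> up x a -> up x b ->
  x a != b -> u \in parabolic [set a; b] -> terminal [set a; b] (x ^ u)%g ->
  c \in [set a; b] -> ~~ pos ((u^-1)%g c).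
Proof.
move=> xI xa xb ne uJ /terminalP ut cJ; set J := [set a; b] in uJ ut cJ *.
have [JG xJ] := up_pair xa xb; have xW := involution_weyl xI.
apply/negP=> rp; set r := (u^-1)%g c in rp.
have rJ : in_span J r by rewrite in_span_parabolic ?groupV ?in_span_simple.
have xrp : pos (x r) by exact: (in_span_pos JG rJ rp xW).
have := in_span_sep xI xa xb ne rJ rp.
have xuE : (x ^ u)%g c = u (x r) by rewrite conjgE !permM.
rewrite -(in_span_parabolic _ JG uJ) -xuE => sep.
suff xucp : pos ((x ^ u)%g c) by move: sep; rewrite ut ?in_span_simple.
have /forall_inPn[d dJ d_neq0] := sep; have /setDP[dG _] := dJ.
apply: (coef_gt0_pos dG); rewrite lt_def d_neq0 xuE (coef_parabolic _ JG uJ dJ).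
exact: (posP _ xrp).
Qed.

(** Both climbs continue to conjugates of [x] that are terminal relative to
[a] and [b], and by [terminal_conj_neg] there is only one such conjugate. *)
Lemma confluence x a b : involution x -> up x a -> up x b -> x a != b ->
  exists2 q, connect climb (x ^ s_ a)%g q & connect climb (x ^ s_ b)%g q.
Proof.
move=> xI xa xb ne; set J := [set a; b]; have [JG _] := up_pair xa xb.
have top c : c \in J -> exists2 u, u \in parabolic J &
  connect climb (x ^ s_ c)%g (x ^ u)%g && terminal J (x ^ u)%g.
  move=> cJ; have cI := involution_conj (s_weyl c) xI.
  have [u uJ] := climb_top JG cI.
  rewrite -conjgM => ut; exists (s_ c * u)%g => //.
  by rewrite groupM ?s_parabolic.
have [u uJ /andP[cu ut]] := top a (set21 _ _).
have [v vJ /andP[cv vt]] := top b (set22 _ _).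
suff uv : u = v by exists (x ^ u)%g => //; rewrite uv.
apply: invg_inj; have lJ := longest_mem J.
have e w : w \in parabolic J -> terminal J (x ^ w)%g ->
    (w^-1)%g = ((longest Gamma J)^-1)%g.
  move=> wJ wt; apply/eqP; rewrite eq_sym eq_invg_mul.
  apply/eqP; apply: (longest_unique JG); rewrite ?groupV //.
    by move=> c; apply: longest_neg.
  by move=> c; apply: (terminal_conj_neg xI xa xb ne).
by rewrite (e u) // (e v).
Qed.

Lemma swap_orth x a b : involution x -> x a = b -> ip a b = 0 ->
  (x ^ s_ a = x ^ s_ b)%g.
Proof.
move=> xI xab ab0; have xW := involution_weyl xI.
have sba : s_ b a = a.
  by apply: val_inj; rewrite sE /cartan ab0 mulr0 mul0r scale0r subr0.
have cab : (s_ a * s_ b = s_ b * s_ a)%g.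
  have := sJ a (s_weyl b); rewrite sba conj_sE => e.
  by rewrite -{1}e -!mulgA s_sqr mulg1.
have xsa : (s_ a * x = x * s_ b)%g.
  by rewrite -xab -(sJ _ xW) conjgE !mulgA mulgV mul1g.
have xsb : (s_ b * x = x * s_ a)%g.
  rewrite -[in s_ a](involutionK a xI) xab -(sJ _ xW).
  by rewrite conjgE !mulgA mulgV mul1g.
by rewrite !conj_sE xsa xsb -!mulgA cab.
Qed.

(** As [m] is an isometry that fixes every [c] in [J],
[ip c b = - ip c a - ip c b]; both products are [<= 0] when [c <> a], so both
vanish. This shows that [a] is isolated and [b] orthogonal to the rest of [J].
Next, [m b = - (a + b)] says that the longest element of [W_J] maps [b] to
[delta a + delta b]; it does not change the coordinate along [b], which is
outside [J], and [delta a] is in [J], so [delta b = b]. *)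
Lemma A2_not_property2 m a b : m \in weyl Phi -> terminal Gamma m ->
  a \in Gamma -> b \in Gamma -> a != b -> ip a a = ip b b -> ip b a != 0 ->
  m a = a -> m b = opp_root (s_ a b) -> ~~ property2 Gamma (J_ Gamma m).
Proof.
move=> mW mt aG bG ab eq_len ne ma mb; have mE := terminal_eq mW mt.
have J1 := terminal_property1 mW mt.
have JG : J_ Gamma m \subset Gamma := J_sub m.
have mJ c : c \in J_ Gamma m -> m c = c by rewrite inE => /andP[_ /eqP].
have bJ : b \notin J_ Gamma m.
  apply/negP=> /mJ e; have := pos_simple bG; rewrite -e mb pos_opp pos_s //.
    exact: pos_simple.
  by rewrite eq_sym.
have aJ : a \in J_ Gamma m by rewrite inE aG ma eqxx.
move: (J_ Gamma m) mE J1 JG mJ bJ aJ => J mE J1 JG mJ bJ aJ.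
have sep c : c \in J :\ a -> ip c a = 0 /\ ip c b = 0.
  case/setD1P=> ca cJ; have cG := subsetP JG c cJ.
  have cb : c != b by apply: contraNneq bJ => <-.
  have := ip_weyl c b mW; rewrite (mJ c cJ) mb ip_oppr ipC ip_sl cartan_A2 //.
  have := simple_ip_le0 aG cG ca; have := simple_ip_le0 bG cG cb.
  rewrite [ip b c]ipC [ip a c]ipC; lra.
rewrite negb_forall_in; apply/exists_inP; exists a.
  rewrite /isolated aJ; apply/forall_inP=> c /sep[ca _]; by rewrite ipC ca.
rewrite negbK; apply/exists_inP; exists b; first by rewrite !inE eq_sym ab.
rewrite eq_len eqxx ne /=; apply/andP; split.
  by apply/forall_inP=> c /sep[_ cb]; rewrite ipC cb.
have daJ : delta a \in J by rewrite property1_delta.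
have wJb : longest Gamma J b = s_ (delta a) (delta b).
  have := mb; rewrite -mE permM => /(congr1 (w0 Gamma)).
  by rewrite w0K weyl_opp ?w0_weyl // weyl_s ?w0_weyl // /delta0 s_opp
    weyl_opp ?s_weyl.
have bJG : b \in Gamma :\: J by rewrite inE bJ.
have := coef_parabolic b JG (longest_mem J) bJG.
have dab : b != delta a by apply: contraNneq bJ => ->.
rewrite wJb coef_s (coef_simple b (subsetP JG _ daJ)) (negPf dab) mulr0 subr0.
rewrite !coef_simple ?delta0_simple // eqxx eq_sym -/(delta b).
by case: eqP => // _ /eqP; rewrite eq_sym oner_eq0.
Qed.

(** A Dynkin diagram contains no triangle: if the product were negative,
integrality would make the square norm of [a + b + c] non-positive. *)
Lemma A2_triangle a b c : a \in Gamma -> b \in Gamma -> c \in Gamma ->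
  a != b -> c != a -> c != b -> ip a a = ip b b -> ip b a != 0 ->
  ip c a = ip c b -> ip c a = 0.
Proof.
move=> aG bG cG ab ca cb eq_len ne eca; apply/eqP/negPn/negP=> ca_neq0.
have ba1 := cartanM b a; rewrite cartan_A2 // in ba1.
have ca_lt0 : ip c a < 0 by rewrite lt_neqAle ca_neq0 simple_ip_le0.
have bound d e : ip d e < 0 -> 2 * ip d e <= - ip e e.
  move=> /cartan_lt0 de; rewrite -cartanM -mulN1r ler_pM2r ?ip_gt0 //.
have b1 := bound c a ca_lt0.
have b2 := bound a c; rewrite ipC in b2; have {}b2 := b2 ca_lt0.
have p_neq0 : val a + val b + val c != 0.
  apply/eqP=> /(congr1 (coef a)); rewrite !linearD linear0 /= !coef_simple //.
  rewrite eqxx (negPf ab) [a == c]eq_sym (negPf ca) !addr0.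
  by move/eqP; rewrite oner_eq0.
have : 0 < rs_dot Phi (val a + val b + val c) (val a + val b + val c).
  exact: neq0_dnorm_gt0.
rewrite !linearD /= !linearDl /= -!/(ip _ _) -eq_len [ip a b]ipC [ip a c]ipC.
rewrite [ip b c]ipC -eca; move: b1 b2 ba1; lra.
Qed.

(** Let [y] be the conjugate. A simple [c] other than [a], [b] is either fixed
by [x] or sent to a negative root. In the first case [c] has the same product
with [a] and [b], which is [0] by [A2_triangle], so that [y c = c]. In the
second case [x c] has a negative coordinate outside [a] and [b], since [x]
preserves the positive roots in the span of [a] and [b], and the reflections in
[a] and [b] do not change it. *)
Lemma swap_terminal x a b : involution x -> up x a -> up x b -> x a = b ->
  a != b -> ip b a != 0 ->
  (forall c, up x c -> c \in [set a; b]) ->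
  [/\ terminal Gamma (x ^ s_ b)%g, (x ^ s_ b)%g a = a &
      (x ^ s_ b)%g b = opp_root (s_ a b)].
Proof.
move=> xI xa xb xab ab ne only.
have [/and3P[aG xap _] /and3P[bG xbp _]] := (xa, xb).
have xba : x b = a by rewrite -xab involutionK.
have xW := involution_weyl xI; have sW c := s_weyl c.
have eq_len : ip a a = ip b b by rewrite -(ip_weyl a a xW) xab.
have sab : s_ a b = s_ b a by apply: s_A2.
have yE c : (x ^ s_ b)%g c = s_ b (x (s_ b c)) by rewrite conj_sE !permM.
have ya : (x ^ s_ b)%g a = a by rewrite yE -sab (weyl_s _ _ xW) xab xba sK.
have yb : (x ^ s_ b)%g b = opp_root (s_ a b).
  by rewrite yE s_id !weyl_opp // xba sab.
split=> //; apply/terminalP=> c cG.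
have [-> // | ca] := eqVneq c a; have [-> | cb] := eqVneq c b.
  by rewrite yb pos_opp pos_s ?pos_simple // eq_sym.
have ncab : c \notin [set a; b] by rewrite !inE negb_or ca.
have [xcp | xcn] := boolP (pos (x c)).
  have xc : x c = c.
    by apply/eqP; apply: contraR ncab => xc; apply: only; rewrite /up cG xcp.
  have eca : ip c a = ip c b by rewrite -(ip_weyl c a xW) xc xab.
  have ca0 := A2_triangle aG bG cG ab ca cb eq_len ne eca.
  have sbc : s_ b c = c.
    by apply: val_inj; rewrite sE /cartan -eca ca0 mulr0 mul0r scale0r subr0.
  by rewrite yE sbc xc sbc.
have [JG xJ] := up_pair xa xb.
rewrite yE (weyl_s _ _ xW) xba -permM.
suff /negPf-> : ~~ pos ((s_ a * s_ b)%g (x c)) by [].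
have [d dJ d_lt0] :
    exists2 d, d \in Gamma :\: [set a; b] & coef d (val (x c)) < 0.
  have xcop : pos (opp_root (x c)) by rewrite pos_opp.
  have /forall_inPn[d dJ d_neq0] : ~~ in_span [set a; b] (opp_root (x c)).
    apply/negP=> xcJ; have := pos_simple cG; apply/negP; rewrite -pos_opp.
    rewrite -[c](involutionK _ xI) -weyl_opp //.
    exact: (in_span_pos JG).
  have /setDP[dG _] := dJ; exists d => //.
  by rewrite -oppr_gt0 -coef_opp lt_def d_neq0 (posP _ xcop).
have /setDP[dG _] := dJ; apply: (coef_lt0_neg dG).
by rewrite (coef_parabolic _ JG _ dJ) // groupM ?s_parabolic // !inE eqxx ?orbT.
Qed.

Lemma conj_s_fix x a : x \in weyl Phi -> s_ (x a) = s_ a -> (x ^ s_ a)%g = x.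
Proof.
move=> xW; rewrite -sJ // => e.
have xs : (x * s_ a = s_ a * x)%g by rewrite -{1}e conjgE !mulgA mulgV mul1g.
by rewrite conj_sE -mulgA xs mulgA s_sqr mul1g.
Qed.

(** * Every conjugate climbs to the top *)

Section Reach.
Variable m : {perm root_of Phi}.
Hypotheses (mI : involution m) (mt : terminal Gamma m).
Hypothesis (m2 : property2 Gamma (J_ Gamma m)).

(** By induction on the length that [x] can still gain, and along the three
cases for two climbs from [x]: [b] is the first step of a climb from [x] to [m], and [a] is
the step to be compared with it. *)
Lemma reach x z : involution x -> connect climb x m -> connect climb x z ->
  connect climb z m.
Proof.
have [n] := ubnP (#|weyl Phi| - len x); elim: n x z => // n IHn x z ltn xI xm.
have IH a q : up x a -> connect climb (x ^ s_ a)%g m ->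
    connect climb (x ^ s_ a)%g q -> connect climb q m.
  move=> xa; apply: IHn; last exact: involution_conj (s_weyl a) xI.
  have := length_bound (x ^ s_ a)%g; rewrite length_up //; lia.
case/connect_climb=> [<- // | [a xa]].
suff xam : connect climb (x ^ s_ a)%g m by exact: IH xam.
have join b c : up x b -> up x c -> x b != c ->
    connect climb (x ^ s_ b)%g m -> connect climb (x ^ s_ c)%g m.
  move=> xb xc ne xbm; have [q bq cq] := confluence xI xb xc ne.
  exact: connect_trans cq (IH b q xb xbm bq).
have [xE | [b xb xbm]] := connect_climb xm.
  have := mt; rewrite terminal_up // => /forall_inP/(_ a (andP xa).1).
  by rewrite -xE xa.
have [xba | ne] := eqVneq (x b) a; last exact: join xbm.
have xab : x a = b by rewrite -xba involutionK.
have ab : a != b by case/and3P: xa => _ _; rewrite xab eq_sym.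
have [ba0 | ne] := eqVneq (ip b a) 0.
  by rewrite (swap_orth xI xab) // ipC.
have [/existsP[c /andP[xc]] | /existsPn no] :=
    boolP [exists c, up x c && (c \notin [set a; b])].
  rewrite !inE negb_or => /andP[ca cb].
  apply: (join c) => //.
    by rewrite -(inj_eq (@perm_inj _ x)) involutionK // xab.
  by apply: join xbm => //; rewrite xba eq_sym.
have only c : up x c -> c \in [set a; b].
  by move=> xc; have := no c; rewrite xc negbK.
have [yt ya yb] := swap_terminal xI xa xb xab ab ne only.
have mE := terminal_connect yt xbm; rewrite -mE in yt ya yb.
have [/and3P[aG _ _] /and3P[bG _ _]] := (xa, xb).
have eq_len : ip a a = ip b b.
  by rewrite -(ip_weyl a a (involution_weyl xI)) xab.
by have := A2_not_property2 (involution_weyl mI) yt aG bG ab eq_len ne ya yb;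
  rewrite m2.
Qed.

(** Conjugation by a simple reflection goes up, goes down or does nothing; one
step up is covered by [reach], and after a step down one climbs back. *)
Lemma class_reach x u : involution x -> connect climb x m -> u \in weyl Phi ->
  connect climb (x ^ u)%g m.
Proof.
rewrite weylE => xI xm uW; move: u uW x xI xm.
apply: gen_ind => [x _ | v u /imsetP[a aG ->] _ IH x xI xm].
  by rewrite conjg1.
have yI := involution_conj (s_weyl a) xI.
rewrite conjgM; apply: IH => //; have xW := involution_weyl xI.
have [xa | xna] := eqVneq (x a) a; first by rewrite conj_s_fix ?xa.
have [xoa | xnoa] := eqVneq (x a) (opp_root a).
  by rewrite conj_s_fix ?xoa ?s_opp.
have [xap | xan] := boolP (pos (x a)).
  by apply: (reach xI xm); apply: climb_up; rewrite /up aG xap.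
have ya : up (x ^ s_ a)%g a.
  have yaE : (x ^ s_ a)%g a = opp_root (s_ a (x a)).
    by rewrite conj_sE !permM s_id !weyl_opp ?s_weyl.
  rewrite /up aG yaE pos_opp pos_s_eq // xan /=.
  rewrite -weyl_opp ?s_weyl // (can2_eq (sK a) (sK a)) s_id.
  by rewrite (can_eq opp_rootK).
apply: connect_trans xm; have := climb_up ya.
by rewrite -conjgM s_sqr conjg1.
Qed.

Lemma length_lt_top x : x \in m ^: weyl Phi -> x != m -> (len x < len m)%N.
Proof.
case/imsetP=> u uW -> ne.
have cm := class_reach mI (connect0 _ _) uW.
have [e | //] := connect_length (involution_conj uW mI) cm.
by rewrite -e eqxx in ne.
Qed.

End Reach.

End Base.
End RootSystem.

Unset Implicit Arguments.

Theorem theorem3p6 (R : realFieldType) (V : vectType R) (Phi : rootSystem V)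
    (Gamma : {set root_of Phi}) (irrPhi : irreducible Phi)
    (baseGamma : is_base Gamma) :
  [/\ {in calM Gamma, forall m, J_ Gamma m \in calJ Gamma},
      {in calJ Gamma, forall J, m_ Gamma J \in calM Gamma},
      {in calM Gamma, cancel (J_ Gamma) (m_ Gamma)} &
      {in calJ Gamma, cancel (m_ Gamma) (J_ Gamma)}].
Proof.
split=> [m mM | J | m mM | J].
- have [mW mt] := calM_terminal baseGamma mM.
  by rewrite inE J_sub terminal_property1 ?calM_property2.
- rewrite inE => /and3P[JG J1 J2]; rewrite inE m_weyl //.
  apply/forall_inP=> x xM; apply/implyP=> ne.
  apply: length_lt_top => //; [exact: m_involution | exact: m_terminal |].
  by rewrite J_mK.
- by have [mW mt] := calM_terminal baseGamma mM; apply: terminal_eq.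
- by rewrite inE => /and3P[JG J1 _]; apply: J_mK.
Qed.
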